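(* For ONline Capacitated Submodular Maximization in which every task has a constant capacity $b_i$, there exists an online algorithm achieving competitive ratio at least $0.436$ (in the regime $T\to\infty$).
   Context: ONline Capacitated Submodular Maximization: we are given in advance a bipartite graph $G=(I,J,E)$ with offline task types $I$ and online worker types $J$, positive integer capacities $b_i$ ($i\in I$) and $b_j$ ($j\in J$), a horizon $T$ and arrival rates $r_j>0$ with $\sum_j r_j=T$; each task $i$ has a monotone submodular utility function $g_i\ge 0$ on subsets of its neighbour set $\mathcal{N}_i$ with $g_i(\emptyset)=0$ (multiple arrivals of the same worker type are treated as distinct workers). Tasks are static; in each round $t=1,\dots,T$ exactly one worker arrives, independently, being of type $j$ with probability $r_j/T$. On arrival of a worker of type $j$ the algorithm must immediately and irrevocably assign it to at most $b_j$ tasks in $\mathcal{N}_j$, each task $i$ receiving at most $b_i$ workers in total. The objective is $\sum_i g_i(S_i)$, $S_i$ the set of workers assigned to $i$. The competitive ratio is the largest $\rho$ such that on every instance the algorithm's expected objective is at least $\rho$ times the expected objective of a clairvoyant optimum that knows the full arrival sequence in advance. Throughout, $T\gg1$ and ratios are evaluated as $T\to\infty$. *)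

(* Defs.v *)
From HB Require Import structures.
From mathcomp Require Import all_boot all_order all_algebra.
From mathcomp Require Import all_classical all_reals all_analysis.

Set Implicit Arguments.
Unset Strict Implicit.
Unset Printing Implicit Defensive.

Import Order.TTheory GRing.Theory Num.Theory.
Local Open Scope ring_scope.

Section SetFunctions.
Variables (R : numDomainType) (V : finType) (N : {set V}) (g : {set V} -> R).

Definition monotone_on :=
  forall A B : {set V}, A \subset B -> B \subset N -> g A <= g B.

Definition submodular_on :=
  forall A B : {set V}, A \subset N -> B \subset N ->
    g (A :|: B) + g (A :&: B) <= g A + g B.

End SetFunctions.

(* Several arrivals of one type are distinct workers: the pair (j, t) is the
   worker of type j arriving in round t, and the utilities are set functions
   on such pairs.  [symmetric_on] says that a utility sees only the types of
   the workers (it is a function of types, extended to several copies of a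
   type): copies of the same type are interchangeable, although a second copy
   may well have a positive marginal value. *)
Definition symmetric_on (R : numDomainType) (J : finType) (T : nat)
    (N : {set J * 'I_T}) (g : {set J * 'I_T} -> R) :=
  forall A B : {set J * 'I_T}, A \subset N -> B \subset N ->
    (forall j : J, #|[set x in A | x.1 == j]| = #|[set x in B | x.1 == j]|) ->
    g A = g B.

Record instance (R : realType) (T : nat) := Instance {
  task : finType;
  wtype : finType;
  edge : task -> wtype -> bool;
  tcap : task -> nat;
  wcap : wtype -> nat;
  rate : wtype -> R;
  util : task -> {set wtype * 'I_T} -> R;
  tcap_gt0 : forall i, (0 < tcap i)%N;
  wcap_gt0 : forall j, (0 < wcap j)%N;
  rate_gt0 : forall j, 0 < rate j;
  rate_sum : \sum_j rate j = T%:R;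
  util_set0 : forall i, util i finset.set0 = 0;
  util_ge0 : forall i (A : {set wtype * 'I_T}),
    A \subset [set x | edge i x.1] -> 0 <= util i A;
  util_monotone : forall i, monotone_on [set x | edge i x.1] (util i);
  util_submodular : forall i, submodular_on [set x | edge i x.1] (util i);
  util_symmetric : forall i, symmetric_on [set x | edge i x.1] (util i)
}.

Section Offline.
Variables (R : realType) (T : nat) (P : instance R T).

(* [w] is the sequence of arriving types; [a t] is the set of tasks to which
   the worker arriving in round t is assigned. *)
Implicit Types (w : T.-tuple (wtype P)) (a : {ffun 'I_T -> {set task P}}).

Definition feasible w a : bool :=
  [&& [forall t, a t \subset [set i | edge i (tnth w t)]],
      [forall t, #|a t| <= wcap (tnth w t)]%N &
      [forall i, #|[set t | i \in a t]| <= tcap i]%N].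

Definition assigned w a (i : task P) : {set wtype P * 'I_T} :=
  [set (tnth w t, t) | t in [set t | i \in a t]].

Definition objective w a : R := \sum_i util i (assigned w a i).

Definition arrival_prob w : R := \prod_(t < T) (rate (tnth w t) / T%:R).

(* The default value 0 is attained by the empty assignment. *)
Definition opt w : R := \big[Num.max/0]_(a | feasible w a) objective w a.

Definition expected_opt : R := \sum_w arrival_prob w * opt w.

End Offline.

(* What a randomized online algorithm does on one given instance: [decide s h]
   is the set of tasks assigned to the last worker of the sequence [h] of types
   arrived so far, when the internal randomness is [s].  Earlier decisions are
   themselves functions of [s] and of prefixes of [h]. *)
Definition run (R : realType) (T : nat) (P : instance R T) (S : Type)
    (decide : S -> seq (wtype P) -> {set task P}) (s : S)
    (w : T.-tuple (wtype P)) : {ffun 'I_T -> {set task P}} :=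
  [ffun t : 'I_T => decide s (take t.+1 w)].

Record policy (R : realType) (T : nat) (P : instance R T) := Policy {
  seed : finType;
  seed_prob : seed -> R;
  decide : seed -> seq (wtype P) -> {set task P};
  seed_prob_ge0 : forall s, 0 <= seed_prob s;
  seed_prob_sum : \sum_s seed_prob s = 1;
  run_feasible : forall s w, feasible w (run decide s w)
}.

Definition expected_value (R : realType) (T : nat) (P : instance R T)
    (p : policy P) : R :=
  \sum_w \sum_s arrival_prob w * seed_prob s * objective w (run (@decide _ _ _ p) s w).

(* The instance (hence T) is known in advance. *)
Definition online_algorithm (R : realType) :=
  forall (T : nat) (P : instance R T), policy P.

(* Largest ratio guaranteed on all instances with horizon T and task capacities
   at most b. *)
Definition competitive_ratio (R : realType) (A : online_algorithm R)
    (b T : nat) : \bar R :=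
  ereal_sup [set rho%:E | rho in [set rho : R |
    forall P : instance R T, (forall i : task P, (tcap i <= b)%N) ->
      rho * expected_opt P <= expected_value (A T P)]]%classic.

(* Main.v *)
Require Import Defs.
From HB Require Import structures.
From mathcomp Require Import all_boot all_order all_algebra.
From mathcomp Require Import all_classical all_reals all_analysis.
From mathcomp Require Import ring lra zify.

(** Let [S_i] be the set of workers that a clairvoyant optimum gives to task
    [i], [O_i] its expected utility and [x_i <= tcap i] its expected size.  An
    online algorithm can replay the optimum: a worker of type [j] is offered to
    the tasks that receive a [j]-worker of a random round in a resampled
    instance.  A task holding a set [A] with room left then gets an offer with
    probability [x_i / T], and by submodularity its expected gain in the round
    is at least [(O_i - g_i A) / T].  Followed backwards in time, this makes
    [g_i A + (1 - shortfall) * max(0, O_i - g_i A)] a submartingale, where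
    [shortfall] depends only on the number of rounds left and on [#|A|].  The
    algorithm below is the derandomization: it picks, among the admissible
    assignments of the arriving worker, one maximizing the sum of these
    potentials, which is at least their average under replay.  It remains to see
    that the shortfall of an empty task with [T] rounds left is at most
    [3 / (2 e)], which holds for every [T > 0] and every capacity. *)

Set Implicit Arguments.
Unset Strict Implicit.
Unset Printing Implicit Defensive.

Import Order.TTheory GRing.Theory Num.Theory.
Local Open Scope ring_scope.

(** * The shortfall recursion and its numerical bound *)

Section Shortfall.
Variables (R : realType) (T b : nat) (y : R).

(* With success probability q = y / T, if a task holding n of b workers is at
   distance D below its benchmark, an offer reduces D on average by D / y. *)
Fixpoint shortfall (k n : nat) : R :=
  if k is k'.+1 then
    if (n < b)%N then
      (1 - y / T%:R) * shortfall k' n + (y - 1) / T%:R * shortfall k' n.+1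
    else 1
  else 1.

Hypotheses (T_gt0 : (0 < T)%N) (y_ge1 : 1 <= y) (y_leT : y <= T%:R).

Let T0 : 0 < T%:R :> R. Proof. by rewrite ltr0n. Qed.
Let stay_ge0 : 0 <= 1 - y / T%:R.
Proof. by rewrite subr_ge0 ler_pdivrMr ?mul1r. Qed.
Let up_ge0 : 0 <= (y - 1) / T%:R.
Proof. by rewrite divr_ge0 ?subr_ge0 ?ler0n. Qed.
Let weights : (1 - y / T%:R) + (y - 1) / T%:R = 1 - 1 / T%:R.
Proof. by rewrite mulrBl; ring. Qed.
Let invT_ge0 : 0 <= 1 / T%:R :> R. Proof. by rewrite divr_ge0 ?ler0n. Qed.

Lemma shortfall_ge0 k n : 0 <= shortfall k n.
Proof.
elim: k n => [|k IH] n /=; first exact: ler01.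
by case: ifP => _; rewrite ?ler01 //; apply: addr_ge0; apply: mulr_ge0.
Qed.

Lemma shortfall_le1 k n : shortfall k n <= 1.
Proof.
elim: k n => [|k IH] n //=; case: ifP => // _.
have h1 := ler_wpM2l stay_ge0 (IH n); have h2 := ler_wpM2l up_ge0 (IH n.+1).
by move: weights invT_ge0; lra.
Qed.

Lemma shortfall_full k n : (b <= n)%N -> shortfall k n = 1.
Proof. by case: k => //= k; rewrite ltnNge => ->. Qed.

(** Both coefficients of the recursion are nonnegative, so the order passes from [k] to [k.+1]; once
    [n.+1] reaches [b], the right side is 1. *)
Lemma shortfall_homo k n : shortfall k n <= shortfall k n.+1.
Proof.
elim: k n => [|k IH] n //=.
case: (ltnP n.+1 b) => [ltnb|_]; last first.
  by have := shortfall_le1 k.+1 n; rewrite /=; case: ifP.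
by rewrite (ltnW ltnb) lerD ?ler_wpM2l.
Qed.

(* [y] need only dominate the true expected demand [x] of the benchmark. *)
Lemma shortfallS_ge (x : R) k n : (n < b)%N -> x <= y ->
  (1 - x / T%:R) * shortfall k n + (x - 1) / T%:R * shortfall k n.+1
    <= shortfall k.+1 n.
Proof.
move=> /= -> le_xy; rewrite -subr_ge0.
rewrite (_ : _ - _ = (y - x) / T%:R * (shortfall k n.+1 - shortfall k n)).
  by rewrite mulr_ge0 ?divr_ge0 ?subr_ge0 ?ler0n ?shortfall_homo.
by field; rewrite gt_eqF.
Qed.

(* The expectation of (N - y + y)^2 / (4 y) where N counts n successes plus
   those of k further trials of success probability y / T; it dominates the
   positive part of N - y by AM-GM. *)
Let excess (k n : nat) : R :=
  ((n%:R + k%:R * (y / T%:R)) ^+ 2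
   + k%:R * (y / T%:R) * (1 - y / T%:R)) / (4 * y).

Let y0 : 0 < y. Proof. exact: lt_le_trans ltr01 y_ge1. Qed.

Let excess_ge0 k n : 0 <= excess k n.
Proof.
rewrite divr_ge0 ?mulr_ge0 ?(ltW y0) //.
by rewrite addr_ge0 ?sqr_ge0 // !mulr_ge0 ?ler0n ?invr_ge0 ?(ltW y0) ?(ltW T0).
Qed.

(** Conditioning on the first of the [k.+1] trials. *)
Let excessS k n :
  excess k.+1 n = (1 - y / T%:R) * excess k n + y / T%:R * excess k n.+1.
Proof. by rewrite /excess -!natr1; field; rewrite !gt_eqF. Qed.

Hypothesis y_leb : y <= b%:R.

(** By Bernoulli's inequality the left side is at most [k / T]. With [m = k * y / T] and
    [y <= b <= n], what remains follows from [4 * y * m <= (y + m)^2]. *)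
Let excess_full k n : (b <= n)%N -> 1 - (1 - 1 / T%:R) ^+ k <= excess k n / y.
Proof.
move=> le_bn.
have bernoulli : 1 - k%:R / T%:R <= (1 - 1 / T%:R) ^+ k :> R.
  elim: {le_bn} k => [|k IH]; first by rewrite expr0 mul0r subr0.
  have le1 : 0 <= 1 - 1 / T%:R :> R.
    by rewrite subr_ge0 ler_pdivrMr // mul1r ler1n.
  rewrite exprS; apply: le_trans (ler_wpM2l le1 IH).
  rewrite -subr_ge0 (_ : _ - _ = k%:R / T%:R ^+ 2).
    by rewrite divr_ge0 ?exprn_ge0 ?ler0n.
  by rewrite -natr1; field; rewrite gt_eqF.
suff: k%:R / T%:R <= excess k n / y by lra.
rewrite ler_pdivlMr // /excess ler_pdivlMr ?mulr_gt0 //.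
set m := k%:R * (y / T%:R).
have m_ge0 : 0 <= m by rewrite mulr_ge0 ?divr_ge0 ?ler0n ?(ltW y0).
have -> : k%:R / T%:R * y * (4 * y) = 4 * y * m by rewrite /m; ring.
have yn : y <= n%:R by apply: le_trans y_leb _; rewrite ler_nat.
have var_ge0 : 0 <= m * (1 - y / T%:R) by rewrite mulr_ge0.
have sq : (y + m) ^+ 2 <= (n%:R + m) ^+ 2.
  by rewrite lerXn2r ?nnegrE ?lerD2r ?addr_ge0 ?ler0n ?(ltW y0).
apply: le_trans (_ : (y + m) ^+ 2 <= _); last by lra.
by rewrite -subr_ge0 (_ : _ - _ = (y - m) ^+ 2) ?sqr_ge0 //; ring.
Qed.

(** The discount per accepted worker: the weight [(y - 1) / T] in [shortfall] is the success
    probability [y / T] times [c]. *)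
Let c := 1 - 1 / y.
Let c_ge0 : 0 <= c. Proof. by rewrite subr_ge0 ler_pdivrMr ?mul1r. Qed.

Let c_le1 : c <= 1.
Proof. by rewrite gerBl divr_ge0 ?(ltW y0). Qed.

(* Without the capacity, c^n * shortfall k n would be the expectation of c^N,
   that is c^n * (1 - 1 / T)^k; stopping at b workers costs c^b - c^N for N > b,
   at most c^b * (N - b) / y. *)
Lemma shortfall_le k n :
  c ^+ n * shortfall k n <=
    c ^+ n * (1 - 1 / T%:R) ^+ k + c ^+ b / y * excess k n.
Proof.
have full k' n' : (b <= n')%N -> c ^+ n' <=
    c ^+ n' * (1 - 1 / T%:R) ^+ k' + c ^+ b / y * excess k' n'.
  move=> le_bn; have cb : c ^+ n' <= c ^+ b by rewrite ler_wiXn2l.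
  have := excess_full k' le_bn.
  have := exprn_ge0 n' c_ge0.
  have p_ge0 : 0 <= excess k' n' / y by rewrite divr_ge0 ?(ltW y0).
  rewrite -mulrA [y^-1 * _]mulrC.
  have := ler_wpM2r p_ge0 cb.
  move=> h1 h2 h3; have := ler_wpM2l h2 h3; lra.
elim: k n => [|k IH] n.
  rewrite expr0 !mulr1 lerDl; apply: mulr_ge0; last exact: excess_ge0.
  by rewrite divr_ge0 ?exprn_ge0 ?(ltW y0).
case: (ltnP n b) => [ltnb|lebn]; last by rewrite shortfall_full ?mulr1 ?full.
rewrite /= ltnb.
have q_ge0 : 0 <= y / T%:R by rewrite divr_ge0 ?ler0n ?(ltW y0).
have := lerD (ler_wpM2l stay_ge0 (IH n)) (ler_wpM2l q_ge0 (IH n.+1)).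
have -> : (y - 1) / T%:R = y / T%:R * c.
  by rewrite /c; field; rewrite !gt_eqF.
have -> : 1 - 1 / T%:R = (1 - y / T%:R) + y / T%:R * c.
  by rewrite /c; field; rewrite !gt_eqF.
by rewrite excessS !exprS; lra.
Qed.

(** Raise [expR (- (1 / 32)) <= 32 / 33], a case of [1 + x <= expR x], to the 32nd power. The
    precision suffices, as [3 / 2 * 0.376 = 0.564]. *)
Let expRN1_le : expR (-1) <= 376 / 1000 :> R.
Proof.
have e32 : 33 / 32 <= expR (1 / 32) :> R.
  by apply: le_trans (expR_ge1Dx _); lra.
have e32_gt0 : 0 < expR (- (1 / 32)) :> R by exact: expR_gt0.
have : expR (- (1 / 32)) <= 32 / 33 :> R.
  have := ler_wpM2l (ltW e32_gt0) e32.
  by rewrite -expRD addNr expR0; lra.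
have -> : -1 = 32%:R * - (1 / 32) :> R by lra.
rewrite expRM_natl => h.
apply: le_trans (_ : (32 / 33) ^+ 32 <= _).
  by rewrite lerXn2r ?nnegrE ?(ltW e32_gt0) ?divr_ge0.
lra.
Qed.

Let one_sub_le (d : R) m : 0 < d -> d <= m%:R -> 1 <= d ->
  (1 - 1 / d) ^+ m <= expR (-1).
Proof.
move=> d0 dm d1; have h : 1 - 1 / d <= expR (- (1 / d)).
  exact: expR_ge1Dx.
have l0 : 0 <= 1 - 1 / d by rewrite subr_ge0 ler_pdivrMr ?mul1r.
apply: le_trans (_ : expR (- (1 / d)) ^+ m <= _).
  by rewrite lerXn2r ?nnegrE ?(ltW (expR_gt0 _)).
rewrite -expRM_natl ler_expR mulrN lerN2.
by rewrite mul1r ler_pdivlMr ?mul1r.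
Qed.

(** Both [(1 - 1 / T)^T] and [c^b] are at most [1 / e], and the latter is weighted by at most
    [1 / 2], for a total of [3 / (2 e)]. *)
Lemma shortfall_bound : shortfall T 0 <= 564 / 1000.
Proof.
have := shortfall_le T 0; rewrite expr0 mul1r => /le_trans; apply.
have T1 : 1 <= T%:R :> R by rewrite ler1n.
have hT := one_sub_le T0 (lexx _) T1.
have hb := one_sub_le y0 y_leb y_ge1; rewrite -/c in hb.
(* The mean is [y] and the variance at most [y], so the ratio is at most [(y^2 + y) / (4 y^2)]; then
   use [y >= 1]. *)
have ex : excess T 0 / y <= 1 / 2.
  have q_ge0 : 0 <= y / T%:R by rewrite divr_ge0 ?ler0n ?(ltW y0).
  rewrite /excess ler_pdivrMr // ler_pdivrMr ?mulr_gt0 //.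
  have -> : T%:R * (y / T%:R) = y by field; rewrite gt_eqF.
  have := ler_wpM2l (ltW y0) y_ge1.
  have := mulr_ge0 (ltW y0) q_ge0.
  lra.
have ex0 : 0 <= excess T 0 / y by rewrite divr_ge0 ?(ltW y0).
rewrite -mulrA [y^-1 * _]mulrC.
have := ler_wpM2r ex0 hb; have := ler_wpM2l (ltW (expR_gt0 (-1 : R))) ex.
have := expRN1_le; lra.
Qed.

End Shortfall.

(** * Product distributions on sequences *)

Section ProductWeights.
Variables (R : comNzRingType) (J : finType) (p : J -> R).

Definition weight m (w : m.-tuple J) : R := \prod_(t < m) p (tnth w t).

Lemma sum_tuple_cons m (F : m.+1.-tuple J -> R) :
  \sum_w F w = \sum_j \sum_(w : m.-tuple J) F [tuple of j :: w].
Proof.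
rewrite pair_big (reindex (fun u : J * m.-tuple J => [tuple of u.1 :: u.2])) //=.
exists (fun w => (thead w, [tuple of behead w])) => [[j w]|w] _ /=.
  by rewrite theadE; congr pair; apply: val_inj.
by rewrite -tuple_eta.
Qed.

Lemma weight_cons m j (w : m.-tuple J) : weight [tuple of j :: w] = p j * weight w.
Proof.
rewrite /weight big_ord_recl tnth0; congr (_ * _); apply: eq_bigr => t _.
by rewrite tnthS.
Qed.

Hypothesis p1 : \sum_j p j = 1.

Lemma sum_weight m : \sum_(w : m.-tuple J) weight w = 1.
Proof.
elim: m => [|m IH].
  rewrite (bigD1 [tuple]) //= big1 ?addr0 => [|w]; first by rewrite /weight big_ord0.
  by case/eqP; apply: tuple0.
rewrite sum_tuple_cons -[RHS]p1; apply: eq_bigr => j _.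
under eq_bigr do rewrite weight_cons.
by rewrite -mulr_sumr IH mulr1.
Qed.

(** Every coordinate has law [p]. This trades the type arriving now for the rounds of a resampled
    sequence, as replay requires. *)
Lemma sum_weight_tnth m (f : J -> R) :
  \sum_(w : m.-tuple J) weight w * (\sum_(t < m) f (tnth w t))
    = m%:R * \sum_j p j * f j.
Proof.
elim: m => [|m IH].
  by rewrite mul0r big1 // => w _; rewrite big_ord0 mulr0.
rewrite sum_tuple_cons.
transitivity (\sum_j (p j * f j + p j * (m%:R * \sum_j p j * f j))).
  apply: eq_bigr => j _; rewrite -IH -[p j * f j]mulr1 -(sum_weight m).
  rewrite !mulr_sumr -big_split /=; apply: eq_bigr => w _.
  rewrite weight_cons big_ord_recl tnth0.
  rewrite [X in f j + X](eq_bigr (fun t => f (tnth w t))); first by ring.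
  by move=> t _; rewrite tnthS.
by rewrite big_split -mulr_suml p1 mul1r /= -natr1 mulrDl mul1r addrC.
Qed.

End ProductWeights.

(** * Marginal values of submodular functions *)

Section Submodular.
Variables (R : realDomainType) (V : finType) (N : {set V}) (g : {set V} -> R).
Hypotheses (g_mono : monotone_on N g) (g_sub : submodular_on N g).

(** Adding the elements of [S] to [A] one at a time, each gains at most its marginal over [A]
    itself. *)
Lemma submodular_sum_marginals (A S : {set V}) : A \subset N -> S \subset N ->
  g S <= g A + \sum_(s in S) (g (s |: A) - g A).
Proof.
move=> AN SN; apply: (@le_trans _ _ (g (A :|: S))).
  by apply: g_mono; rewrite ?finset.subsetUr // finset.subUset AN.
have [n] := ubnP #|S|; elim: n S SN => // n IH S SN.
case: (set_0Vmem S) => [->|[x xS]]; first by rewrite finset.setU0 big_set0 addr0.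
rewrite (cardsD1 x) xS (big_setD1 x xS) /= => leSn.
have S'N : S :\ x \subset N by apply: fintype.subset_trans SN; exact: subD1set.
have xN : x \in N by exact: (fintype.subsetP SN).
have xAN : x |: A \subset N by rewrite finset.subUset finset.sub1set xN.
have USN : A :|: S :\ x \subset N by rewrite finset.subUset AN.
have := g_sub USN xAN.
have -> : (A :|: S :\ x) :|: (x |: A) = A :|: S.
  apply/setP=> z; rewrite !inE.
  by case: eqP => [->|]; rewrite ?xS; case: (z \in A); rewrite ?orbT ?orbF.
have IA : g A <= g ((A :|: S :\ x) :&: (x |: A)).
  apply: g_mono; first by rewrite finset.subsetI finset.subsetUl finset.subsetUr.
  by apply: fintype.subset_trans USN; rewrite finset.subsetIl.
have := IH _ S'N leSn; lra.
Qed.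
End Submodular.

(** * The clairvoyant benchmark and the potential-greedy policy *)

Section GreedyPolicy.
Variables (R : realType) (T : nat) (P : instance R T).
Local Notation J := (wtype P).
Local Notation I := (task P).
Implicit Types (w : T.-tuple J) (i : I) (j : J) (A : {set J * 'I_T}).

Definition hindsight w : {ffun 'I_T -> {set I}} :=
  [arg max_(a > [ffun=> finset.set0] | feasible w a) objective w a]%O.

Lemma hindsightP w :
  feasible w (hindsight w) /\ opt w <= objective w (hindsight w).
Proof.
rewrite /hindsight; case: Order.TotalTheory.arg_maxP => [|a aP amax].
  apply/and3P; split; apply/forallP => t; rewrite ?ffunE ?finset.sub0set ?cards0 //.
  rewrite (_ : [set _ | _] = finset.set0) ?cards0 //.
  by apply/setP => u; rewrite !inE ffunE inE.
(* The maximum defining [opt] starts at 0, so the best objective must also be shown nonnegative. *)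
split=> //; apply: Order.POrderTheory.bigmax_le => //.
apply: sumr_ge0 => i _; apply: util_ge0; apply/fintype.subsetP => x /imsetP[t].
rewrite !inE => it -> /=.
by have /and3P[/forallP/(_ t)/fintype.subsetP/(_ _ it)] := aP; rewrite inE.
Qed.

(** The [x_i] of the overview; [target] is its [O_i]. *)
Definition demand i : R :=
  \sum_w arrival_prob w * #|[set t | i \in hindsight w t]|%:R.

Definition target i : R :=
  \sum_w arrival_prob w * util i (assigned w (hindsight w) i).

Definition workers i : {set J * 'I_T} := [set x | edge i x.1].

Lemma in_assigned w (a : {ffun 'I_T -> {set I}}) i j t :
  ((j, t) \in assigned w a i) = (tnth w t == j) && (i \in a t).
Proof.
apply/imsetP/andP => [[u] | [/eqP <- it]]; last by exists t; rewrite ?inE.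
by rewrite inE => iu [-> ->].
Qed.

Lemma assigned_sub w a i : feasible w a -> assigned w a i \subset workers i.
Proof.
move=> aP; apply/fintype.subsetP => -[j t]; rewrite in_assigned => /andP[/eqP <- it].
by have /and3P[/forallP/(_ t)/fintype.subsetP/(_ _ it)] := aP; rewrite !inE.
Qed.

Lemma expected_opt_le : expected_opt P <= \sum_i target i.
Proof.
rewrite exchange_big; apply: ler_sum => w _ /=.
rewrite -mulr_sumr; apply: ler_wpM2l; last by case: (hindsightP w).
by apply: prodr_ge0 => t _; rewrite divr_ge0 ?ler0n ?ltW ?rate_gt0.
Qed.

(* The copy of an optimal worker that arrives now is worth at least as much as
   the worker itself: by symmetry if that worker is not already in A, by
   monotonicity otherwise. *)
Lemma util_le_marginals w a i A (now : 'I_T) : feasible w a ->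
  A \subset workers i -> (forall j, (j, now) \notin A) ->
  util i (assigned w a i) <=
    util i A + \sum_(t | i \in a t) (util i ((tnth w t, now) |: A) - util i A).
Proof.
move=> aP AN newA; have SN := assigned_sub i aP.
apply: le_trans (submodular_sum_marginals
  (@util_monotone _ _ P i) (@util_submodular _ _ P i) AN SN) _.
rewrite lerD2l {1}/assigned big_imset /=; last by move=> t u _ _ [].
rewrite (eq_bigl (fun t => i \in a t)) => [|t]; last by rewrite inE.
apply: ler_sum => t it; rewrite lerD2r.
have tN u : (tnth w t, u) \in workers i.
  have : (tnth w t, t) \in workers i.
    by apply: (fintype.subsetP SN); rewrite in_assigned eqxx.
  by rewrite !inE.
have tAN u : (tnth w t, u) |: A \subset workers i.
  by rewrite finset.subUset finset.sub1set tN.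
have [tA|tA] := boolP ((tnth w t, t) \in A).
  rewrite (finset.setUidPr _) ?finset.sub1set //.
  by apply: util_monotone; rewrite ?finset.subsetUr.
rewrite le_eqVlt; apply/orP; left; apply/eqP/util_symmetric => // j.
have card_new u : (tnth w t, u) \notin A ->
    #|[set x in (tnth w t, u) |: A | x.1 == j]|
      = ((tnth w t == j) + #|[set x in A | x.1 == j]|)%N.
  move=> uA; case: eqP => [<-|ne]; last first.
    congr #|pred_of_set _|; apply/setP => x; rewrite !inE.
    by case: eqP => //= ->; rewrite (negbTE uA) /=; apply/eqP.
  rewrite (_ : [set x in _ | _] = (tnth w t, u) |: [set x in A | x.1 == tnth w t]).
    by rewrite cardsU1 inE (negbTE uA).
  by apply/setP => x; rewrite !inE; case: eqP => //= ->; rewrite eqxx.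
by rewrite !card_new.
Qed.

(* For [y < 1] the recursion defining [shortfall] has a negative coefficient. *)
Definition effective_demand i : R := Num.max 1 (demand i).

(** Here [k] rounds are left. At [k = 0] the shortfall is 1 and only the utility remains. *)
Definition task_potential k i A : R :=
  util i A + (1 - shortfall T (tcap i) (effective_demand i) k #|A|)
             * Num.max 0 (target i - util i A).

Local Notation log := (seq (J * {set I})).
Implicit Types (st : log).

(** The position of an entry in the log is its round, which makes repeated arrivals of a type
    distinct workers. *)
Definition received st i : {set J * 'I_T} :=
  [set x : J * 'I_T | if onth st x.2 is Some (j, U) then (j == x.1) && (i \in U) else false].

Lemma received_nil i : received [::] i = finset.set0.
Proof. by apply/setP => x; rewrite !inE onth0n. Qed.

Lemma received_now st i j (now : 'I_T) : (size st <= now)%N ->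
  (j, now) \notin received st i.
Proof. by move=> le_st; rewrite inE /= onth_default. Qed.

Lemma received_rcons st j (U : {set I}) i (lt_st : (size st < T)%N) :
  received (rcons st (j, U)) i =
    if i \in U then (j, Ordinal lt_st) |: received st i else received st i.
Proof.
apply/setP => -[j' t]; rewrite (fun_if (fun A : {set _} => (j', t) \in A)) !inE /=.
rewrite -cats1 onth_cat xpair_eqE -val_eqE /= [j' == j]eq_sym.
case: ltngtP => /= [lt_t|lt_t|->].
- by case: (i \in U); rewrite ?andbF.
- rewrite !onth_default ?(ltnW lt_t) ?subn_gt0 //.
  by case: (i \in U); rewrite ?andbF.
- by rewrite subnn /= onth_default //= andbT orbF; case: (i \in U); rewrite ?andbT ?andbF.
Qed.

Definition potential k st : R := \sum_i task_potential k i (received st i).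

Definition free st : {set I} := [set i | #|received st i| < tcap i]%N.

Definition admissible st j (U : {set I}) :=
  [&& U \subset [set i | edge i j], (#|U| <= wcap j)%N & U \subset free st].

Definition choose st j : {set I} :=
  [arg max_(U > finset.set0 | admissible st j U)
     potential (T - (size st).+1) (rcons st (j, U))]%O.

Lemma chooseP st j : admissible st j (choose st j) /\
  forall U, admissible st j U ->
    potential (T - (size st).+1) (rcons st (j, U)) <=
    potential (T - (size st).+1) (rcons st (j, choose st j)).
Proof.
rewrite /choose; case: Order.TotalTheory.arg_maxP => [|U UP Umax] //.
by rewrite /admissible !finset.sub0set cards0.
Qed.

Definition step st j : log := rcons st (j, choose st j).

Definition play (h : seq J) : log := foldl step [::] h.

(** The policy is deterministic and sees only types, so [play] recomputes its earlier choices. *)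
Definition greedy (_ : unit) (h : seq J) : {set I} :=
  last finset.set0 [seq e.2 | e <- play h].

Lemma play_rcons h j : play (rcons h j) = step (play h) j.
Proof. by rewrite /play -cats1 foldl_cat. Qed.

Lemma size_play h : size (play h) = size h.
Proof.
by elim/last_ind: h => // h j IH; rewrite play_rcons !size_rcons IH.
Qed.

Lemma greedy_rcons h j : greedy tt (rcons h j) = choose (play h) j.
Proof. by rewrite /greedy play_rcons map_rcons last_rcons. Qed.

Definition valid st :=
  forall i, (received st i \subset workers i) && (#|received st i| <= tcap i)%N.

Lemma valid_step st j : (size st < T)%N -> valid st -> valid (step st j).
Proof.
move=> lt_st v i; have /andP[sub le] := v i; rewrite (received_rcons _ _ _ lt_st).
have [/and3P[/fintype.subsetP edges _ /fintype.subsetP fr] _] := chooseP st j.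
case: ifP => iU; last by rewrite sub.
rewrite finset.subUset finset.sub1set sub cardsU1 received_now // andbT.
by have := edges _ iU; have := fr _ iU; rewrite !inE /= => -> ->.
Qed.

Lemma valid_play h : (size h <= T)%N -> valid (play h).
Proof.
elim/last_ind: h => [|h j IH] => [_ i|].
  by rewrite received_nil finset.sub0set cards0.
rewrite size_rcons play_rcons => lt_h.
by apply: valid_step; rewrite ?size_play //; apply/IH/ltnW.
Qed.

Lemma onth_play h t j : onth h t = Some j ->
  onth (play h) t = Some (j, greedy tt (take t.+1 h)).
Proof.
elim/last_ind: h => [|h j' IH]; first by rewrite onth0n.
rewrite play_rcons /step -!cats1 !onth_cat size_play.
case: ltngtP => [lt_t|lt_t|->].
- by move=> /IH ->; rewrite takel_cat.
- by rewrite onth_default ?subn_gt0.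
- rewrite subnn /= => -[->].
  by rewrite take_oversize ?cats1 ?greedy_rcons // size_rcons.
Qed.

Lemma received_play w i : received (play w) i = assigned w (run greedy tt w) i.
Proof.
apply/setP => -[j t]; rewrite in_assigned inE ffunE.
by have /tnth_onth/onth_play -> := erefl (tnth w t).
Qed.

Lemma greedy_feasible s w : feasible w (run greedy s w).
Proof.
case: s.
have dec t : run greedy tt w t = choose (play (take t w)) (tnth w t).
  rewrite ffunE (take_nth (tnth w t)) ?size_tuple // greedy_rcons.
  by rewrite -tnth_nth.
apply/and3P; split; apply/forallP => t.
- by rewrite dec; have [/and3P[]] := chooseP (play (take t w)) (tnth w t).
- by rewrite dec; have [/and3P[]] := chooseP (play (take t w)) (tnth w t).
have := valid_play (h := w); rewrite size_tuple => /(_ (leqnn _) t)/andP[_].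
by rewrite received_play card_imset // => u u' [].
Qed.

Lemma sum_unit (F : unit -> R) : \sum_s F s = F tt.
Proof. by rewrite (bigD1 tt) //= big1 ?addr0 // => -[]. Qed.

Definition greedy_policy : policy P := {|
  seed := unit;
  seed_prob := fun=> 1;
  decide := greedy;
  seed_prob_ge0 := fun=> ler01;
  seed_prob_sum := sum_unit (fun=> 1);
  run_feasible := greedy_feasible |}.

(** * The potential does not decrease on average *)

Section PositiveHorizon.
Hypothesis T_gt0 : (0 < T)%N.

Let arrival j : R := rate j / T%:R.

Let arrival_ge0 w : 0 <= arrival_prob w.
Proof. by apply: prodr_ge0 => t _; rewrite divr_ge0 ?ler0n ?ltW ?rate_gt0. Qed.

Let arrival1 : \sum_j arrival j = 1.
Proof. by rewrite -mulr_suml rate_sum divff ?pnatr_eq0 -?lt0n. Qed.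

Let sum_arrival : \sum_(w : T.-tuple J) arrival_prob w = 1.
Proof. exact: sum_weight arrival1 T. Qed.

Let average (F : T.-tuple J -> R) (m : R) :
  (forall w, m <= F w) -> m <= \sum_w arrival_prob w * F w.
Proof.
move=> mF; rewrite -[m]mul1r -sum_arrival mulr_suml.
by apply: ler_sum => w _; rewrite ler_wpM2l.
Qed.

Let average_le (F : T.-tuple J -> R) (m : R) :
  (forall w, F w <= m) -> \sum_w arrival_prob w * F w <= m.
Proof.
move=> Fm; rewrite -[m]mul1r -sum_arrival mulr_suml.
by apply: ler_sum => w _; rewrite ler_wpM2l.
Qed.

Lemma demand_le_tcap i : demand i <= (tcap i)%:R.
Proof.
apply: average_le => w; rewrite ler_nat.
by have [/and3P[_ _ /forallP/(_ i)]] := hindsightP w.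
Qed.

Lemma demand_le_horizon i : demand i <= T%:R.
Proof.
apply: average_le => w; rewrite ler_nat -[X in (_ <= X)%N]card_ord; exact: max_card.
Qed.

Let effective_demand_bounds i : [/\ 1 <= effective_demand i,
  effective_demand i <= T%:R & effective_demand i <= (tcap i)%:R].
Proof.
by rewrite le_max lexx !ge_max demand_le_horizon demand_le_tcap !ler1n T_gt0 tcap_gt0.
Qed.

Lemma task_potential_step k i A (now : 'I_T) :
  A \subset workers i -> (forall j, (j, now) \notin A) -> (#|A| < tcap i)%N ->
  T%:R * task_potential k.+1 i A <=
    \sum_w arrival_prob w * \sum_t
      task_potential k i (if i \in hindsight w t then (tnth w t, now) |: A else A).
Proof.
move=> AN newA A_free; have [y1 yT _] := effective_demand_bounds i.
have AtN w t : i \in hindsight w t -> (tnth w t, now) |: A \subset workers i.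
  move=> it; rewrite finset.subUset AN finset.sub1set inE andbT /=.
  have [/and3P[/forallP/(_ t)/fintype.subsetP/(_ _ it)]] := hindsightP w.
  by rewrite inE.
have card_new j : #|(j, now) |: A| = #|A|.+1 by rewrite cardsU1 newA.
have := shortfallS_ge T_gt0 y1 yT k A_free (_ : demand i <= _).
rewrite le_max lexx orbT => /(_ isT).
rewrite /task_potential.
set y := effective_demand i in y1 yT *.
have s_le1 n m : 0 <= 1 - shortfall T (tcap i) y n m by rewrite subr_ge0 shortfall_le1.
have s'_ge0 := shortfall_ge0 (tcap i) T_gt0 y1 yT k #|A|.+1.
set S := shortfall T (tcap i) y k.+1 #|A|.
set s := shortfall T (tcap i) y k #|A|.
set s' := shortfall T (tcap i) y k #|A|.+1 in s'_ge0 *.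
move=> step; set g := util i A; set D := target i - g.
(* At or above the target the potential is just the utility, and monotonicity suffices. *)
have [D_le0|D_gt0] := leP D 0.
  rewrite mulr0 addr0; apply: average => w; rewrite mulr_natl -[T in _ *+ T]card_ord -sumr_const.
  apply: ler_sum => t _; case: ifP => it.
    rewrite -[leLHS]addr0 lerD ?mulr_ge0 ?le_max ?lexx //.
    by apply: util_monotone; rewrite ?finset.subsetUr ?AtN.
  by rewrite lerDl mulr_ge0 ?le_max ?lexx.
have T0 : T%:R != 0 :> R by rewrite pnatr_eq0 -lt0n.
(* A round without an offer contributes [g + (1 - s) * D]; an offer of marginal value [d] adds at
   least [(s - s') * D + s' * d]. The marginals over one sequence sum to at least its benchmark
   utility minus [g]. *)
apply: (@le_trans _ _ (\sum_w arrival_prob w *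
   (T%:R * (g + (1 - s) * D) + #|[set t | i \in hindsight w t]|%:R * ((s - s') * D)
     + s' * (util i (assigned w (hindsight w) i) - g)))).
  have -> : \sum_w arrival_prob w *
   (T%:R * (g + (1 - s) * D) + #|[set t | i \in hindsight w t]|%:R * ((s - s') * D)
     + s' * (util i (assigned w (hindsight w) i) - g))
    = T%:R * (g + (1 - s) * D) + demand i * ((s - s') * D) + s' * D.
    under eq_bigr do rewrite mulrDr mulrDr.
    rewrite !big_split /= -mulr_suml sum_arrival mul1r; congr (_ + _ + _).
      by rewrite /demand mulr_suml; apply: eq_bigr => w _; rewrite mulrA.
    transitivity (s' * (target i - (\sum_(w : T.-tuple J) arrival_prob w) * g)).
      rewrite /target mulr_suml -sumrB mulr_sumr.
      by apply: eq_bigr => w _; ring.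
    by rewrite sum_arrival mul1r.
  have := ler_wpM2r (ltW D_gt0) (ler_wpM2l (ler0n R T) step).
  rewrite (_ : T%:R * _ = (T%:R - demand i) * s + (demand i - 1) * s').
    by lra.
  by field.
apply: ler_sum => w _; rewrite ler_wpM2l //.
have [aP _] := hindsightP w.
have := util_le_marginals aP AN newA; rewrite -/g.
set G := \sum_(t | _) _ => uG.
apply: (@le_trans _ _ (\sum_(t < T) ((g + (1 - s) * D) +
   (if i \in hindsight w t then (s - s') * D + s' * (util i ((tnth w t, now) |: A) - g) else 0)))).
  rewrite big_split /= sumr_const card_ord -[in leRHS]mulr_natl -addrA lerD2l -big_mkcond /=.
  rewrite big_split /= sumr_const -[in leRHS]mulr_natl -mulr_sumr cardsE lerD2l.
  by rewrite ler_wpM2l // lerBlDl.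
apply: ler_sum => t _; case: ifP => it; last first.
  by rewrite addr0 -/g -/D max_r ?(ltW D_gt0).
rewrite card_new -/s'; set u := util i _.
have le1 : 0 <= 1 - s' by rewrite s_le1.
have : target i - u <= Num.max 0 (target i - u) by rewrite le_max lexx orbT.
by move=> /(ler_wpM2l le1); rewrite /D; lra.
Qed.

(** The greedy choice does at least as well as replaying any round of a resampled optimum restricted
    to [free] tasks, hence as well as their average. *)
Lemma potential_step k st : T = (size st + k.+1)%N -> valid st ->
  potential k.+1 st <= \sum_j arrival j * potential k (step st j).
Proof.
move=> defT v; have lt_st : (size st < T)%N by lia.
pose now := Ordinal lt_st.
have T0 : 0 < T%:R :> R by rewrite ltr0n.
rewrite -(ler_pM2l T0) -(sum_weight_tnth arrival1 T (fun j => potential k (step st j))).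
apply: (@le_trans _ _ (\sum_w arrival_prob w *
   \sum_t potential k (rcons st (tnth w t, hindsight w t :&: free st)))); last first.
  apply: ler_sum => w _; rewrite ler_wpM2l //; apply: ler_sum => t _.
  have [_ choose_max] := chooseP st (tnth w t).
  have defk : (T - (size st).+1)%N = k by lia.
  rewrite defk in choose_max; apply: choose_max.
  have [/and3P[/forallP/(_ t) e /forallP/(_ t) c _] _] := hindsightP w.
  apply/and3P; split; last exact: finset.subsetIr.
    by apply: fintype.subset_trans e; exact: finset.subsetIl.
  by apply: leq_trans c; apply: subset_leq_card; exact: finset.subsetIl.
have -> : \sum_w arrival_prob w *
   \sum_t potential k (rcons st (tnth w t, hindsight w t :&: free st))
  = \sum_i \sum_w arrival_prob w * \sum_t task_potential k i
      (received (rcons st (tnth w t, hindsight w t :&: free st)) i).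
  rewrite [RHS]exchange_big; apply: eq_bigr => w _ /=.
  by rewrite -mulr_sumr exchange_big.
rewrite /potential mulr_sumr; apply: ler_sum => i _.
have /andP[sub _] := v i.
have [i_free|i_full] := ltnP #|received st i| (tcap i).
  apply: le_trans (task_potential_step k sub (now := now) _ i_free) _ => [j|].
    exact: received_now.
  rewrite le_eqVlt; apply/orP; left; apply/eqP/eq_bigr => w _; congr (_ * _).
  apply: eq_bigr => t _; rewrite (received_rcons _ _ _ lt_st).
  by rewrite finset.in_setI [i \in free _]inE i_free andbT.
(* A full task receives nothing and has shortfall 1 for every [k], so its potential stays
   constant. *)
apply: average => w; rewrite mulr_natl -[T in _ *+ T]card_ord -sumr_const.
apply: ler_sum => t _; rewrite (received_rcons _ _ _ lt_st).
rewrite finset.in_setI [i \in free _]inE ltnNge i_full andbF.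
by rewrite /task_potential !shortfall_full.
Qed.

Lemma potential_run k st : T = (size st + k)%N -> valid st ->
  potential k st <= \sum_(u : k.-tuple J) weight arrival u * potential 0 (foldl step st u).
Proof.
elim: k st => [|k IH] st defT v.
  rewrite (bigD1 [tuple]) //= big1 ?addr0 => [|u]; last by case/eqP; apply: tuple0.
  by rewrite /weight big_ord0 mul1r.
apply: le_trans (potential_step defT v) _.
rewrite sum_tuple_cons; apply: ler_sum => j _.
under eq_bigr do rewrite weight_cons -mulrA.
rewrite -mulr_sumr ler_wpM2l ?divr_ge0 ?ler0n ?(ltW (rate_gt0 j)) //.
apply: (IH (step st j)); first by rewrite size_rcons; lia.
by apply: valid_step => //; lia.
Qed.

Lemma target_ge0 i : 0 <= target i.
Proof.
apply: sumr_ge0 => w _; apply: mulr_ge0 => //; apply: util_ge0.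
by apply: assigned_sub; case: (hindsightP w).
Qed.

Lemma greedy_ratio :
  436 / 1000 * expected_opt P <= expected_value greedy_policy.
Proof.
have -> : expected_value greedy_policy =
    \sum_(u : T.-tuple J) weight arrival u * potential 0 (foldl step [::] u).
  apply: eq_bigr => w _; rewrite [LHS]sum_unit /= mulr1; congr (_ * _).
  apply: eq_bigr => i _; rewrite -received_play /task_potential /=.
  by rewrite subrr mul0r addr0.
apply: le_trans (potential_run (st := [::]) (k := T) _ _) => //; last first.
  exact: (valid_play (h := [::])).
apply: le_trans (_ : 436 / 1000 * (\sum_i target i) <= _).
  have c_ge0 : 0 <= 436 / 1000 :> R by lra.
  exact: ler_wpM2l c_ge0 _ _ expected_opt_le.
rewrite mulr_sumr; apply: ler_sum => i _.
rewrite /task_potential received_nil util_set0 cards0 add0r subr0.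
rewrite max_r ?target_ge0 //; apply: ler_wpM2r (target_ge0 i) _ _ _.
have [y1 yT yb] := effective_demand_bounds i.
(* The ratio is [1 - 0.564 = 0.436]. *)
by have := shortfall_bound T_gt0 y1 yT yb; lra.
Qed.

End PositiveHorizon.
End GreedyPolicy.

(** * Passage to the limit in the horizon *)

Lemma limn_einf_ge (R : realType) (u : nat -> \bar R) (l : \bar R) :
  (forall n, (0 < n)%N -> (l <= u n)%E) -> (l <= limn_einf u)%E.
Proof.
move=> lu; rewrite limn_einf_lim.
rewrite (cvg_lim _ (@cvg_einfs_sup _ u)) //.
(* The tail starting at 1 leaves out horizon 0. *)
apply: le_trans (ereal_sup_ubound _); last by exists 1%N.
by apply: le_ereal_inf_tmp => _ [n /= n1 <-]; apply: lu.
Qed.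

Theorem theorem3 (R : realType) :
  exists A : online_algorithm R, forall b : nat,
    ((436 / 1000 : R)%:E <= limn_einf (fun T : nat => competitive_ratio A b T))%E.
Proof.
exists (@greedy_policy R) => b; apply: limn_einf_ge => T T_gt0.
apply: ereal_sup_ubound; exists (436 / 1000) => // P _.
exact: greedy_ratio.
Qed.
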